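(* Let $H$, $H_x$, $H_v$ be real Hilbert spaces with $H_x\otimes H_v\subseteq H$, such that $\mathrm{Span}\{r\otimes s : r\in H_x,\ s\in H_v\}$ is dense in $H$ and the set $\Sigma=\{r\otimes s : r\in H_x,\ s\in H_v\}$ is weakly closed in $H$. Let $\mathbf{b}:H\to\mathbb{R}$ be a continuous linear form, let $\widetilde{\mathbf{a}}:H\times H\to\mathbb{R}$ be a continuous bilinear form (not necessarily symmetric or coercive), let $\widetilde{A}\in\mathcal{L}(H;H)$ be the continuous linear operator such that $\widetilde{\mathbf{a}}(g_1,g_2)=\langle \widetilde{A}g_1,g_2\rangle_H$ for all $g_1,g_2\in H$, and let $g_0\in H$. Consider the Fixed-point PGD algorithm for $(\widetilde{\mathbf{a}},\mathbf{b},g_0)$ (defined in the context). Then all the iterations of the Fixed-point PGD algorithm are well-defined, in the sense that for all $n\in\mathbb{N}$ there exists at least one solution $(r_{n+1},s_{n+1})\in H_x\times H_v$ to the minimization problem $$(r_{n+1},s_{n+1})\in \mathop{\mathrm{argmin}}_{(r,s)\in H_x\times H_v}\mathcal{E}_n(r\otimes s)$$ defining the $n$-th iteration. Moreover, assume that $\widetilde{A}=\sum_{\mu=1}^M \widetilde{A}_x^\mu\otimes\widetilde{A}_v^\mu$, where for all $1\le\mu\le M$, $\widetilde{A}_x^\mu\in\mathcal{L}(H_x;H_x)$ and $\widetilde{A}_v^\mu\in\mathcal{L}(H_v;H_v)$, and let $$\kappa:=\max_{1\le\mu\le M}\left\|\widetilde{A}_x^\mu\otimes\widetilde{A}_v^\mu\right\|_{\mathcal{L}(H;H)}.$$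 Assume that at least one of the following two assumptions is satisfied: (A1) $H=H_x\otimes H_v$ (thus $\|r\otimes s\|_H=\|r\|_{H_x}\|s\|_{H_v}$ for all $(r,s)\in H_x\times H_v$) and $3M\kappa<1$; (A2) $5M\kappa<1$. Then there is a unique $f\in H$ such that $$\forall g\in H,\quad \langle f,g\rangle_H+\widetilde{\mathbf{a}}(f,g)=\mathbf{b}(g),$$ and the sequence $(f_n)_{n\in\mathbb{N}}$ produced by the Fixed-point PGD algorithm converges strongly in $H$ to $f$.
   Context: Notation. $\langle\cdot,\cdot\rangle_H$ and $\|\cdot\|_H$ denote the scalar product and norm of $H$; $\mathcal{L}(H;H)$ is the space of continuous linear operators on $H$ with the operator norm. The inclusion $H_x\otimes H_v\subseteq H$ means that for $r\in H_x$, $s\in H_v$ the pure tensor product $r\otimes s$ is an element of $H$ and the algebraic tensor product of $H_x$ and $H_v$ is identified in this way with a linear subspace of $H$. (The typical situation is that $H_x$, $H_v$, $H$ are spaces of real-valued functions on $\Omega_x$, $\Omega_v$, $\Omega_x\times\Omega_v$ respectively, and $(r\otimes s)(x,v)=r(x)s(v)$.) In (A1), $H=H_x\otimes H_v$ means that $H$ is the Hilbert space tensor product of $H_x$ and $H_v$, with $\langle r\otimes s,r'\otimes s'\rangle_H=\langle r,r'\rangle_{H_x}\langle s,s'\rangle_{H_v}$. For operators $A_x$ on $H_x$ and $A_v$ on $H_v$, $A_x\otimes A_v$ denotes the operator on $H$ such that $(A_x\otimes A_v)(r\otimes s)=(A_xr)\otimes(A_vs)$ for all $(r,s)\in H_x\times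 H_v$; the operators $\widetilde{A}_x^\mu\otimes\widetilde{A}_v^\mu$ are understood to be bounded operators on $H$. Fixed-point PGD algorithm (for given $\widetilde{\mathbf{a}}$, $\mathbf{b}$ and initial guess $g_0\in H$). Initialization: set $n=0$ and $f_0=g_0$. Iterate on $n\ge 0$: compute $(r_{n+1},s_{n+1})\in H_x\times H_v$ as a solution (any one) of the minimization problem $$(r_{n+1},s_{n+1})\in\mathop{\mathrm{argmin}}_{(r,s)\in H_x\times H_v}\mathcal{E}_n(r\otimes s),$$ where for all $g\in H$, $$\mathcal{E}_n(g)=\tfrac12\langle f_n+g,f_n+g\rangle_H-\mathbf{b}(f_n+g)-\widetilde{\mathbf{a}}(f_n,f_n+g)\ \text{ with the sign of the last term corrected to }+,\ \text{i.e. }\ \mathcal{E}_n(g)=\tfrac12\langle f_n+g,f_n+g\rangle_H-\mathbf{b}(f_n+g)+\widetilde{\mathbf{a}}(f_n,f_n+g).$$ Define $f_{n+1}:=f_n+r_{n+1}\otimes s_{n+1}$ and set $n=n+1$. Equivalently, with $b\in H$ the Riesz representative of $\mathbf{b}$ and $I$ the identity on $H$, $(r_{n+1},s_{n+1})$ minimizes $\|b-(I+\widetilde{A})f_n-r\otimes s\|_H^2$ over $(r,s)\in H_x\times H_v$. *)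

(* Defs.v *)
From HB Require Import structures.
From mathcomp Require Import all_boot all_order all_algebra.
From mathcomp Require Import all_classical all_reals all_analysis.

Set Implicit Arguments.
Unset Strict Implicit.
Unset Printing Implicit Defensive.

Import Order.TTheory GRing.Theory Num.Theory.
Import numFieldNormedType.Exports.

Local Open Scope classical_set_scope.
Local Open Scope ring_scope.

HB.mixin Record CompleteNormedModule_isHilbert (R : realType) H
    of CompleteNormedModule R H := {
  inner : {dot H for @idfun R} ;
  inner_normE : forall x : H, inner x x = `|x| ^+ 2
}.

#[short(type="hilbertType")]
HB.structure Definition Hilbert (R : realType) :=
  {H of CompleteNormedModule R H & CompleteNormedModule_isHilbert R H}.

Notation "''<' x , y '>'" := (inner x y)
  (at level 0, x, y at level 69, format "''<' x ,  y '>'") : ring_scope.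

Section Functional.
Context {R : realType}.

(* The coarsest topology making every norm-continuous linear form
   continuous. *)
Definition weak_space (H : normedModType R) : topologicalType :=
  sup_topology (fun phi : {phi : {scalar H} | continuous (phi : H -> R)} =>
    Topological.on (initial_topology (sval phi : H -> R))).

Definition weakly_closed (H : normedModType R) (S : set H) : Prop :=
  closed (S : set (weak_space H)).

Definition linspan (H : lmodType R) (S : set H) : set H :=
  [set g | exists n (c : 'I_n -> R) (v : 'I_n -> H),
     (forall i, S (v i)) /\ g = \sum_i c i *: v i].

Definition opnorm (V W : normedModType R) (T : {linear V -> W}) : R :=
  sup [set `|T x| | x in [set x : V | `|x| <= 1]].

Definition argmin (T : Type) (E : T -> R) : set T :=
  [set x | forall y, E x <= E y].

End Functional.

Section Tensor.
Context {R : realType}.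

(* [(T, tau)] is characterised, up to isomorphism, by its universal property. *)
Definition is_algebraic_tensor (U V T : lmodType R)
    (tau : {bilinear U -> V -> T}) : Prop :=
  forall (W : lmodType R) (beta : {bilinear U -> V -> W}),
    exists ell : {linear T -> W},
      (forall u v, ell (tau u v) = beta u v) /\
      (forall ell' : {linear T -> W},
         (forall u v, ell' (tau u v) = beta u v) -> ell' =1 ell).

(* [tens] identifies the algebraic tensor product with a linear subspace
   of [H]: the linear map it induces on that product is injective. *)
Definition tensor_subspace (U V H : lmodType R)
    (tens : {bilinear U -> V -> H}) : Prop :=
  exists (T : lmodType R) (tau : {bilinear U -> V -> T}) (j : {linear T -> H}),
    [/\ is_algebraic_tensor tau, injective j &
        forall u v, j (tau u v) = tens u v].

Context {Hx Hv H : hilbertType R}.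
Implicit Type tens : {bilinear Hx -> Hv -> H}.

Definition pure_tensors tens : set H :=
  [set g | exists r s, g = tens r s].

Definition is_hilbert_tensor tens : Prop :=
  dense (linspan (pure_tensors tens)) /\
  forall r r' s s', '<tens r s, tens r' s'> = '<r, r'> * '<s, s'>.

(* A bounded operator [T] on [H] is "[Ax] (x) [Av]"; such a [T] is unique
   when pure tensors span a dense subspace. *)
Definition is_tensor_operator tens (Ax : {linear Hx -> Hx})
    (Av : {linear Hv -> Hv}) (T : {linear H -> H}) : Prop :=
  continuous T /\ forall r s, T (tens r s) = tens (Ax r) (Av s).

End Tensor.

Section PGD.
Context {R : realType} {Hx Hv H : hilbertType R}.
Variables (tens : {bilinear Hx -> Hv -> H}).
Variables (a : {biscalar H}) (b : {scalar H}) (g0 : H).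

Definition pgd_energy (f g : H) : R :=
  2^-1 * '<f + g, f + g> - b (f + g) + a f (f + g).

Definition pgd_argmin (f : H) : set (Hx * Hv) :=
  argmin (fun p : Hx * Hv => pgd_energy f (tens p.1 p.2)).

(* The iterates f_0, ..., f_N and (r_1, s_1), ..., (r_N, s_N) are produced by
   the first [N] iterations; [r 0] and [s 0] are irrelevant. Minimizers need
   not be unique, hence a relation. *)
Definition pgd_upto (N : nat) (f : nat -> H) (r : nat -> Hx) (s : nat -> Hv)
    : Prop :=
  f 0%N = g0 /\
  forall n, (n < N)%N ->
    pgd_argmin (f n) (r n.+1, s n.+1) /\
    f n.+1 = f n + tens (r n.+1) (s n.+1).

Definition pgd_run (f : nat -> H) (r : nat -> Hx) (s : nat -> Hv) : Prop :=
  forall N, pgd_upto N f r s.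

End PGD.

(* Main.v *)
Require Import Defs.
From HB Require Import structures.
From mathcomp Require Import all_boot all_order all_algebra.
From mathcomp Require Import all_classical all_reals all_analysis.
From mathcomp Require Import ring lra.

Set Implicit Arguments.
Unset Strict Implicit.
Unset Printing Implicit Defensive.

Import Order.TTheory GRing.Theory Num.Theory.
Import numFieldNormedType.Exports.

Local Open Scope classical_set_scope.
Local Open Scope ring_scope.

(** Write [beta] for the Riesz representative of [b] and
    [u_n = beta - f_n - A f_n] for the residual. Up to a constant independent
    of [g], the energy at step [n] is [`|u_n - g| ^+ 2 / 2], so an iteration
    looks for a best approximation [z_n] of [u_n] by a pure tensor.

    Existence. A minimizing sequence of pure tensors is bounded, so along an
    ultrafilter it converges weakly ([ultra_bounded_weak_cvg], from Riesz's
    theorem); the limit is a pure tensor by weak closedness, and it minimizes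
    because the norm is weakly lower semicontinuous
    ([best_approx_exists]).

    Decrease of the residual. The set of pure tensors is a cone, so [u - z] is
    orthogonal to [z], and [`|z|] dominates the dual norm of [u], the supremum
    of [`|'<u, w>| / `|w|] over pure tensors [w]. The residual [u - z] has dual
    norm at most [c * `|z|], where [c = 2] always works, by the triangle
    inequality, and [c = 1] works for the Hilbert tensor product: there [z] carries the largest singular value
    of [u] and [u - z] the others. Each of the [M] terms of [A] maps pure
    tensors to pure tensors, hence with [q = M * kappa] the next residual
    [u - z - A z] satisfies
    [`|u - z - A z| ^+ 2 <= `|u| ^+ 2 - (1 - 2 * c * q - q ^+ 2) * `|z| ^+ 2].
    The smallness assumption makes the coefficient positive, so [`|u_n|]
    decreases and the series of the [`|z_n| ^+ 2] converges.

    Convergence. Since [`|z_n|] tends to [0] and bounds the dual norm of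
    [u_n], density of the span of pure tensors makes [u_n] tend weakly to [0]
    ([residual_weak_cvg0]). To obtain norm convergence, write
    [`|u_m| ^+ 2 = '<u_m, u_0> - \sum_(k < m) '<u_m, z_k + A z_k>]. The first
    term tends to [0], and the sum is at most
    [(1 + q) * `|z_m| * \sum_(k < m) `|z_k|], which is arbitrarily small for
    some arbitrarily large [m] because the [`|z_k|] are square summable
    ([square_summable_sparse]). Monotonicity of [`|u_n|] extends this to the
    whole sequence ([residual_cvg0]).

    Finally [q < 1], so [I + A] is bijective and bounded below. The solution
    [f] of [f + A f = beta] satisfies [u_n = (I + A) (f - f_n)], and
    [f_n --> f] follows. *)

(** * Inner products *)

(** A quadratic polynomial in [t] that is nonnegative everywhere has
    nonpositive discriminant. Below, the polynomial is a quadratic functional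
    along a line through a point that minimizes it up to a multiple of [c]. *)
Lemma discriminant_le (R : realType) (c p q : R) : 0 <= q ->
  (forall t, 0 <= c - 2 * t * p + t ^+ 2 * q) -> p ^+ 2 <= c * q.
Proof.
rewrite le_eqVlt => /predU1P[<-|q0] h; last first.
  have := h (p / q).
  have -> : c - 2 * (p / q) * p + (p / q) ^+ 2 * q = c - p ^+ 2 / q.
    by field; rewrite gt_eqF.
  by rewrite subr_ge0 ler_pdivrMr.
have [->|p0] := eqVneq p 0; first by rewrite expr0n mulr0.
have := h ((c + 1) / (2 * p)).
have -> : c - 2 * ((c + 1) / (2 * p)) * p + ((c + 1) / (2 * p)) ^+ 2 * 0 = -1.
  by field; rewrite p0.
by rewrite oppr_ge0 ler10.
Qed.

Section InnerProduct.
Context {R : realType} {H : hilbertType R}.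
Implicit Types (x y z : H) (a : R).

Lemma innerC x y : '<x, y> = '<y, x>.
Proof. by rewrite (hermC (@inner R H)) expr0 mul1r. Qed.

Lemma innerDl x y z : '<x + y, z> = '<x, z> + '<y, z>.
Proof. exact: linearDl. Qed.
Lemma innerNl x z : '<- x, z> = - '<x, z>.
Proof. exact: linearNl. Qed.
Lemma innerZl a x z : '<a *: x, z> = a * '<x, z>.
Proof. exact: linearZl_LR. Qed.
Lemma innerDr x y z : '<z, x + y> = '<z, x> + '<z, y>.
Proof. by rewrite innerC innerDl !(innerC z). Qed.
Lemma innerNr x z : '<z, - x> = - '<z, x>.
Proof. by rewrite innerC innerNl innerC. Qed.
Lemma innerZr a x z : '<z, a *: x> = a * '<z, x>.
Proof. by rewrite innerC innerZl innerC. Qed.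

Lemma inner_suml n (v : 'I_n -> H) z :
  '<\sum_i v i, z> = \sum_i '<v i, z>.
Proof. exact: linear_sumlz. Qed.
Lemma inner_sumr n (v : 'I_n -> H) z :
  '<z, \sum_i v i> = \sum_i '<z, v i>.
Proof. by rewrite innerC inner_suml; apply: eq_bigr => i _; rewrite innerC. Qed.

Definition innerE := (innerDl, innerNl, innerZl, innerDr, innerNr, innerZr).

Lemma inner_ge0 x : 0 <= '<x, x>.
Proof. by rewrite inner_normE sqr_ge0. Qed.

Lemma cauchy_schwarz x y : `|'<x, y>| <= `|x| * `|y|.
Proof.
rewrite -ler_sqr ?nnegrE ?mulr_ge0// exprMn -!inner_normE.
rewrite real_normK ?num_real//.
apply: discriminant_le (inner_ge0 y) _ => t.
have := inner_ge0 (x - t *: y); rewrite !innerE (innerC y x).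
by congr (_ <= _); ring.
Qed.

End InnerProduct.

(** * Riesz's theorem *)

Lemma minimizing_seq (R : realType) (T : Type) (S : set T) (E : T -> R) :
  S !=set0 -> (forall x, 0 <= E x) ->
  exists (x_ : nat -> T) (m : R),
    (forall n, S (x_ n) /\ E (x_ n) < m + n.+1%:R^-1) /\
    (forall x, S x -> m <= E x).
Proof.
move=> S0 E0; set m := inf (E @` S).
have hinf : has_inf (E @` S).
  by split; [have [x Sx] := S0; exists (E x), x|exists 0 => _ [x _ <-]].
have /choice[x_ xP] n : exists x, S x /\ E x < m + n.+1%:R^-1.
  have [|_ [x Sx <-] xlt] := inf_adherent _ hinf (eps := n.+1%:R^-1).
    by rewrite invr_gt0.
  by exists x.
exists x_, m; split=> // x Sx.
by apply: ge_inf; [exact: hinf.2|exists x].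
Qed.

Section Riesz.
Context {R : realType} {H : hilbertType R}.
Implicit Types (x y g : H).

Lemma inner_continuousl g : continuous (fun x => '<x, g>).
Proof.
move=> x; apply/cvgrPdist_le => e e0.
have g0 : 0 < `|g| + 1 by rewrite ltr_wpDl.
have : \forall y \near x, `|x - y| <= e / (`|g| + 1).
  by apply: cvgr_dist_le; [exact: cvg_id|rewrite divr_gt0].
apply: filterS => y yx; rewrite -innerNl -innerDl.
apply: le_trans (cauchy_schwarz _ _) _.
rewrite ler_pdivlMr// in yx; apply: le_trans yx.
by rewrite ler_wpM2l// lerDl.
Qed.

(** The representative of [L] is the minimizer of [`|x| ^+ 2 / 2 - L x]: by
    the parallelogram identity a minimizing sequence [x_] is Cauchy, and the
    discriminant bound shows that ['<x_ n, g> - L g] tends to [0]. [L] is a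
    plain function with linearity as hypotheses because it will be a limit
    obtained pointwise by choice. *)
Lemma riesz (L : H -> R) (C : R) :
    (forall x y, L (x + y) = L x + L y) ->
    (forall t x, L (t *: x) = t * L x) ->
    (forall x, `|L x| <= C * `|x|) ->
  exists w : H, forall g, L g = '<w, g>.
Proof.
move=> LD LZ LC.
(* The constant [C ^+ 2 / 2] makes [J] nonnegative. *)
pose J x := 2^-1 * '<x, x> - L x + C ^+ 2 / 2.
have J0 x : 0 <= J x.
  have := LC x; rewrite /J inner_normE => /ler_normlP[_].
  have := sqr_ge0 (`|x| - C); rewrite sqrrB => + h; nra.
have [x_ [m [xP mP]]] := @minimizing_seq R H setT J (ex_intro _ 0 I) J0.
have Jm y : m <= J y by exact: mP.
have close n : 0 <= J (x_ n) - m < n.+1%:R^-1.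
  by rewrite subr_ge0 Jm/= ltrBlDl; exact: (xP n).2.
have near_cvg e : 0 < e -> \forall n \near \oo, J (x_ n) - m < e.
  move=> e0; have := near_infty_natSinv_lt (PosNum e0).
  apply: filterS => n; apply: lt_trans.
  by have /andP[] := close n.
(* The midpoint of two terms has [J >= m], so
   [`|x_ n - x_ k| ^+ 2 <= 4 * ((J (x_ n) - m) + (J (x_ k) - m))]. *)
have xC : cauchy (x_ @ \oo).
  apply/cauchy_ballP => e e0.
  have e1 : 0 < e ^+ 2 / 8 by rewrite divr_gt0// exprn_gt0.
  have nn := near_cvg _ e1.
  rewrite near_simpl.
  exists ([set n | J (x_ n) - m < e ^+ 2 / 8],
          [set n | J (x_ n) - m < e ^+ 2 / 8]); first by split.
  move=> [n k] [/= hn hk]; rewrite -ball_normE /=.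
  rewrite -ltr_sqr ?nnegrE ?(ltW e0)// -inner_normE.
  have := Jm (2^-1 *: (x_ n + x_ k)).
  rewrite /J !(LZ, LD, innerE) (innerC (x_ k) (x_ n)).
  move: hn hk; rewrite /J; set a := '<x_ n, x_ n>; set b := '<x_ k, x_ k>.
  set c := '<x_ n, x_ k>; lra.
have xx : x_ @ \oo --> lim (x_ @ \oo) by exact: cauchy_cvg.
set x := lim _ in xx; exists x => g; apply/esym.
have dir n : ('<x_ n, g> - L g) ^+ 2 <= 2 * (J (x_ n) - m) * '<g, g>.
  apply: discriminant_le (inner_ge0 g) _ => t.
  have := Jm (x_ n - t *: g).
  rewrite -scaleNr /J !(LZ, LD, innerE) (innerC g (x_ n)).
  nra.
have cvg1 : ('<x_ n, g>) @[n --> \oo] --> '<x, g>.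
  exact: continuous_cvg (@inner_continuousl g x) xx.
have cvg2 : ('<x_ n, g>) @[n --> \oo] --> L g.
  apply/cvgrPdist_lt => e e0.
  have q0 : 0 < '<g, g> + 1 by rewrite ltr_wpDl// inner_ge0.
  have e1 : 0 < e ^+ 2 / (2 * ('<g, g> + 1)).
    by rewrite divr_gt0 ?exprn_gt0// mulr_gt0.
  apply: filterS (near_cvg _ e1) => n.
  rewrite ltr_pdivlMr ?mulr_gt0// => hn.
  rewrite distrC -ltr_sqr ?nnegrE ?(ltW e0)// real_normK ?num_real//.
  apply: le_lt_trans (dir n) _; apply: le_lt_trans hn.
  have /andP[h _] := close n; have := inner_ge0 g; nra.
exact: cvg_unique cvg1 cvg2.
Qed.

End Riesz.

(** * Weak compactness and best approximation *)

Section WeakCompactness.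
Context {R : realType}.

Lemma ultra_bounded_cvg (T : Type) (F : set_system T) (FF : UltraFilter F)
    (f : T -> R) (C : R) :
  F [set x | `|f x| <= C] -> exists l : R, f @ F --> l.
Proof.
move=> FC.
have fC : F (f @^-1` `[- C, C]).
  by apply: filterS FC => x; rewrite /= in_itv/= ler_norml.
have [l [_ clu]] := @segment_compact R (- C) C (f @ F) _ fC.
exists l => A lA.
have [//|FnA] := in_ultra_setVsetC (f @^-1` A) FF.
by have [y []] := clu (~` A) A FnA lA.
Qed.

(** Weak compactness of balls: the limits of the inner products [<x, g>] form
    a bounded linear form in [g], which Riesz's theorem turns into a vector. *)
Lemma ultra_bounded_weak_cvg (H : hilbertType R) (F : set_system H)
    (FF : UltraFilter F) (C : R) : F [set x | `|x| <= C] ->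
  exists w : H, forall g, '<x, g> @[x --> F] --> '<w, g>.
Proof.
move=> FC.
have bnd g : F [set x | `|'<x, g>| <= C * `|g|].
  apply: filterS FC => x /= xC.
  by apply: le_trans (cauchy_schwarz _ _) _; rewrite ler_wpM2r.
have /choice[L LP] g : exists l : R, '<x, g> @[x --> F] --> l.
  exact: ultra_bounded_cvg (bnd g).
have [|t x||w wE] := @riesz R H L C.
- move=> x y; apply: cvg_unique (LP (x + y)) _ => //.
  rewrite (_ : (fun z => _) = (fun z => '<z, x>) \+ (fun z => '<z, y>)).
    exact: cvgD.
  by apply/funext => z; rewrite /= innerDr.
- apply: cvg_unique (LP (t *: x)) _ => //.
  rewrite (_ : (fun z => _) = (fun z => t * '<z, x>)).
    exact: cvgMr.
  by apply/funext => z; rewrite innerZr.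
- move=> g.
  suff : L g \in `[- (C * `|g|), C * `|g|] by rewrite in_itv/= ler_norml.
  suff : closed [set` `[- (C * `|g|), C * `|g|]] ->
      [set` `[- (C * `|g|), C * `|g|]] (L g).
    by apply; exact: interval_closed.
  move=> cl; apply: (closed_cvg _ cl _ _ (LP g)).
  by apply: filterS (bnd g) => x; rewrite /= in_itv/= ler_norml.
- by exists w => g; rewrite -wE.
Qed.

(** Riesz's theorem makes inner products the only continuous linear forms, so
    they suffice to test convergence in the weak topology. *)
Lemma weak_space_cvg (H : hilbertType R) (F : set_system H) (FF : Filter F)
    (w : H) : (forall g, '<x, g> @[x --> F] --> '<w, g>) ->
  F --> (w : weak_space H).
Proof.
move=> Fw; apply/cvg_sup => -[phi phic] A /=.
have /linear_boundedP/pinfty_ex_gt0[C _ phiC] : bounded_near phi (nbhs 0).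
  exact/linear_bounded_continuous.
have [|t x|v vE] := @riesz R H phi C _ _ phiC.
- exact: linearD.
- exact: linearZ.
case=> _ [[B Bo <-] Bw BA]; apply: filterS BA _ => /=.
have /Fw/= : nbhs '<w, v> B.
  by apply: open_nbhs_nbhs; split => //; rewrite innerC -vE.
suff -> : phi @^-1` B = (fun x => '<x, v>) @^-1` B by [].
by apply/seteqP; split=> x /=; rewrite innerC -vE.
Qed.

(** A minimizing sequence converges weakly to some [z] along an ultrafilter
    [F], and [z] lies in [S]. In the inequality
    [`|u - z| ^+ 2 <= `|u - x| ^+ 2 + 2 * '<x - z, u - z>] the last term tends
    to [0] as [x] follows [F]. *)
Lemma best_approx_exists (H : hilbertType R) (S : set H) (u : H) :
  S !=set0 -> weakly_closed S ->
  exists2 z, S z & forall y, S y -> `|u - z| <= `|u - y|.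
Proof.
move=> S0 Scl; pose E x := '<u - x, u - x>.
have E0 x : 0 <= E x := inner_ge0 (u - x).
have [x_ [m [xP mP]]] := minimizing_seq S0 E0.
have [F [FU xF]] := ultraFilterLemma (_ : ProperFilter (x_ @ \oo)).
have FS : F S by apply: xF; exists 0%N => // n _; exact: (xP n).1.
have FE e : 0 < e -> F [set x | E x < m + e].
  move=> e0; apply: xF; have := near_infty_natSinv_lt (PosNum e0).
  apply: filterS => n /= ne; apply: lt_trans (xP n).2 _.
  by rewrite ltrD2l.
have [|z zw] := @ultra_bounded_weak_cvg H F FU (`|u| + (m + 1 + 1)).
  apply: filterS (FE 1 ltr01) => x /=; rewrite /E inner_normE => h.
  (* [`|u - x| <= `|u - x| ^+ 2 + 1] avoids square roots. *)
  rewrite -[x](subKr u); apply: le_trans (ler_normB _ _) _.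
  by rewrite lerD2l; have := sqr_ge0 (`|u - x| - 1); nra.
have Sz : S z.
  apply: Scl => B zB.
  have FB : F B by exact: (weak_space_cvg _ zw zB).
  have [x Bx] := filter_ex (filterI FS FB).
  by exists x.
exists z => // y Sy.
rewrite -ler_sqr ?nnegrE// -!inner_normE; apply: le_trans (mP _ Sy).
apply/ler_addgt0Pr => e e0.
have /cvgrPdist_lt/(_ (e/4)) : '<x, u - z> @[x --> F] --> '<z, u - z> := zw _.
have e4 : 0 < e / 4 by rewrite divr_gt0.
have e2 : 0 < e / 2 by rewrite divr_gt0.
move=> /(_ e4) => Fz.
have [x [/= /ltr_normlP[h1 h2] h3]] := filter_ex (filterI Fz (FE _ e2)).
have := inner_ge0 (x - z).
move: h1 h2 h3; rewrite /E !innerE (innerC x u) (innerC z u) (innerC z x); lra.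
Qed.

End WeakCompactness.

(** * Best approximation from a cone *)

Section BestApproximation.
Context {R : realType} {H : hilbertType R}.
Implicit Types (u z w y : H) (S : set H).

Definition best_approx S u z :=
  S z /\ forall y, S y -> `|u - z| <= `|u - y|.

Variables (S : set H) (u z : H).
Hypothesis SZ : forall t y, S y -> S (t *: y).
Hypothesis uz : best_approx S u z.

Lemma best_approx_le y : S y -> '<u - z, u - z> <= '<u - y, u - y>.
Proof. by rewrite !inner_normE ler_sqr ?nnegrE//; exact: uz.2. Qed.

Lemma best_approx_orthogonal w :
  (forall t, S (z + t *: w)) -> '<u - z, w> = 0.
Proof.
move=> Sw; apply/eqP; rewrite -sqrf_eq0 eq_le sqr_ge0 andbT -(mul0r '<w, w>).
apply: discriminant_le (inner_ge0 w) _ => t.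
have := best_approx_le (Sw t).
rewrite opprD addrA !innerE (innerC z u) (innerC w u) (innerC w z); lra.
Qed.

Lemma best_approx_residual_orthogonal : '<u - z, z> = 0.
Proof.
apply: best_approx_orthogonal => t.
by rewrite -[X in X + _]scale1r -scalerDl; apply: SZ; exact: uz.1.
Qed.

Lemma best_approx_inner : '<u, z> = '<z, z>.
Proof.
by have := best_approx_residual_orthogonal; rewrite !innerE => /subr0_eq.
Qed.

(** For all [t], [`|u - t *: w| ^+ 2 >= `|u - z| ^+ 2 = `|u| ^+ 2 - `|z| ^+ 2];
    the discriminant of this inequality in [t] is the claim. *)
Lemma best_approx_dual_norm w : S w -> `|'<u, w>| <= `|z| * `|w|.
Proof.
move=> Sw.
rewrite -ler_sqr ?nnegrE ?mulr_ge0// exprMn -!inner_normE.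
rewrite real_normK ?num_real//.
apply: discriminant_le (inner_ge0 w) _ => t.
have := best_approx_le (SZ t Sw).
rewrite !innerE (innerC z u) (innerC w u) best_approx_inner; lra.
Qed.

Lemma best_approx_residual_dual_norm w :
  S w -> `|'<u - z, w>| <= 2 * `|z| * `|w|.
Proof.
move=> Sw; rewrite innerDl innerNl; apply: le_trans (ler_normB _ _) _.
by have := best_approx_dual_norm Sw; have := cauchy_schwarz z w; lra.
Qed.

(** Orthogonality of [u - z] and [z] gives
    [`|u - z| ^+ 2 = `|u| ^+ 2 - `|z| ^+ 2]; the perturbation [y] then costs a
    cross term and a square. It will be the image of [z] by the non-identity
    part of the operator. *)
Lemma best_approx_step (c q : R) (y : H) :
    0 <= c -> 0 <= q ->
    `|'<u - z, y>| <= c * q * `|z| ^+ 2 -> `|y| <= q * `|z| ->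
  `|u - z - y| ^+ 2 <= `|u| ^+ 2 - (1 - 2 * c * q - q ^+ 2) * `|z| ^+ 2.
Proof.
move=> c0 q0 /ler_normlP[h _] yq.
have : `|y| ^+ 2 <= q ^+ 2 * `|z| ^+ 2.
  by rewrite -exprMn ler_sqr ?nnegrE ?mulr_ge0.
move: h; rewrite -!inner_normE !innerE.
rewrite (innerC y u) (innerC z u) (innerC y z) best_approx_inner; lra.
Qed.

End BestApproximation.

(** Let [z = tens r0 s0]. Varying one factor of [z] at a time shows that [u - z]
    is orthogonal to [tens r0 s] and [tens r s0] for all [r] and [s]. Hence in
    the pairing of [u - z] with [tens r s] only the components [r'] and [s']
    of [r] and [s] orthogonal to [r0] and [s0] contribute; [tens r' s'] is
    orthogonal to [z], so the dual norm of [u] itself applies. *)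
Lemma hilbert_tensor_residual_dual_norm (R : realType)
    (H Hx Hv : hilbertType R) (tens : {bilinear Hx -> Hv -> H}) (u z : H) :
    (forall r r' s s', '<tens r s, tens r' s'> = '<r, r'> * '<s, s'>) ->
    best_approx (pure_tensors tens) u z ->
  forall w, pure_tensors tens w -> `|'<u - z, w>| <= `|z| * `|w|.
Proof.
move=> tensE uz _ [r [s ->]].
have SZ t y : pure_tensors tens y -> pure_tensors tens (t *: y).
  by move=> [r1 [s1 ->]]; exists (t *: r1), s1; rewrite linearZl_LR.
have [[r0 [s0 z_eq]] _] := uz.
have orthr s1 : '<u - z, tens r0 s1> = 0.
  apply: (best_approx_orthogonal uz) => t.
  by exists r0, (s0 + t *: s1); rewrite z_eq linearDr linearZr_LR.
have orths r1 : '<u - z, tens r1 s0> = 0.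
  apply: (best_approx_orthogonal uz) => t.
  by exists (r0 + t *: r1), s0; rewrite z_eq linearDl linearZl_LR.
have split (K : hilbertType R) (x0 x : K) : exists a x',
    [/\ x = a *: x0 + x', '<x0, x'> = 0 & '<x', x'> <= '<x, x> ].
  have [x00|x00] := eqVneq '<x0, x0> 0.
    exists 0, x; split; rewrite ?scale0r ?add0r//.
    apply/eqP; rewrite -normr_le0.
    apply: le_trans (cauchy_schwarz _ _) _.
    have : `|x0| ^+ 2 = 0 by rewrite -inner_normE.
    by move/eqP; rewrite sqrf_eq0 => /eqP ->; rewrite mul0r.
  pose a := '<x, x0> / '<x0, x0>.
  have a_eq : a * '<x0, x0> = '<x, x0> by rewrite divfK.
  have a_ge0 : 0 <= a * '<x, x0>.
    by rewrite mulrAC -expr2 divr_ge0 ?sqr_ge0 ?inner_ge0.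
  exists a, (x - a *: x0); split.
  - by rewrite addrC subrK.
  - by rewrite !innerE (innerC x0 x) a_eq subrr.
  - by rewrite !innerE (innerC x0 x) a_eq; lra.
have [a [r' [-> r0r' r'r]]] := split _ r0 r.
have [d [s' [-> s0s' s's]]] := split _ s0 s.
have -> : '<u - z, tens (a *: r0 + r') (d *: s0 + s')> = '<u, tens r' s'>.
  rewrite [tens _ _]linearDl [tens (a *: r0) _]linearZl_LR.
  rewrite innerDr innerZr orthr mulr0 add0r.
  rewrite [tens _ _]linearDr [tens _ (d *: s0)]linearZr_LR.
  rewrite innerDr innerZr orths mulr0 add0r.
  by rewrite innerDl innerNl z_eq tensE r0r' mul0r subr0.
apply: le_trans (best_approx_dual_norm SZ uz _) _; first by exists r', s'.
rewrite ler_wpM2l// -ler_sqr ?nnegrE// -!inner_normE !tensE.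
by rewrite ler_pM ?inner_ge0.
Qed.

(** * Operator norm *)

Lemma opnormP (R : realType) (V W : normedModType R) (T : {linear V -> W}) :
  continuous T -> forall x, `|T x| <= opnorm T * `|x|.
Proof.
move=> /linear_bounded_continuous/linear_boundedP/pinfty_ex_gt0[C C0 TC] x.
have ub : has_ubound [set `|T x| | x in [set x : V | `|x| <= 1]].
  exists C => _ [y /= y1 <-]; apply: le_trans (TC y) _.
  by rewrite ger_pMr.
have [->|x0] := eqVneq x 0; first by rewrite linear0 !normr0 mulr0.
have nx0 : 0 < `|x| by rewrite normr_gt0.
rewrite -ler_pdivrMr// /opnorm; apply: (ub_le_sup ub).
exists (`|x|^-1 *: x); first by rewrite /= normrZ normfV normr_id mulVf ?gt_eqF.
by rewrite linearZ/= normrZ normfV normr_id mulrC.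
Qed.

(** * Square summable sequences *)

Section SquareSummable.
Context {R : realType}.
Variables (a : nat -> R) (B : R).
Hypothesis a_ge0 : forall k, 0 <= a k.
Hypothesis a_sqr : forall n, \sum_(0 <= k < n) a k ^+ 2 <= B.

Lemma square_summable_tail e : 0 < e ->
  exists N, forall N' n, (N <= N')%N -> (N' <= n)%N ->
    \sum_(N' <= k < n) a k ^+ 2 <= e.
Proof.
move=> e0; set s := fun n => \sum_(0 <= k < n) a k ^+ 2.
have hs : has_sup (range s).
  by split; [exists (s 0%N), 0%N|exists B => _ [n _ <-]; exact: a_sqr].
have [_ [N _ <-] sN] := sup_adherent e0 hs.
exists N => N' n NN' N'n.
have s_split i j : (i <= j)%N -> s j = s i + \sum_(i <= k < j) a k ^+ 2.
  by move=> ij; rewrite /s (big_cat_nat _ ij).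
have tail0 i j : 0 <= \sum_(i <= k < j) a k ^+ 2.
  by apply: sumr_ge0 => k _; exact: sqr_ge0.
have sn : s n <= sup (range s) by apply: ub_le_sup hs.2 _ _; exists n.
have := s_split _ _ N'n; have := s_split _ _ NN'; have := tail0 N N'; lra.
Qed.

Lemma square_summable_cvg0 e : 0 < e ->
  exists N, forall n, (N <= n)%N -> a n <= e.
Proof.
move=> e0; have [N NP] := square_summable_tail (exprn_gt0 2 e0).
exists N => n Nn; rewrite -ler_sqr ?nnegrE ?(ltW e0)//.
by have := NP n n.+1 Nn (leqnSn _); rewrite big_nat1.
Qed.

(** Choose [N'] past which the tail of the series of squares is at most
    [e / 2], and let [m >= N'] be the first index at which [a] is below a
    threshold making the first [N'] terms contribute at most [e / 2]. Between
    [N'] and [m] the sequence stays above [a m], so that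
    [a m * a k <= a k ^+ 2] there. *)
Lemma square_summable_sparse N e : 0 < e ->
  exists2 m, (N <= m)%N & a m * \sum_(0 <= k < m) a k <= e.
Proof.
move=> e0; have e2 : 0 < e / 2 by rewrite divr_gt0.
have [N1 N1P] := square_summable_tail e2.
pose N' := maxn N N1; set s := \sum_(0 <= k < N') a k.
have s0 : 0 <= s by apply: sumr_ge0 => k _; exact: a_ge0.
have eta0 : 0 < e / 2 / (s + 1) by rewrite divr_gt0// ltr_wpDl.
have [N2 N2P] := square_summable_cvg0 eta0.
have [m /andP[N'm am] mmin] : {m | (N' <= m)%N && (a m <= e / 2 / (s + 1)) &
    forall k, (N' <= k)%N && (a k <= e / 2 / (s + 1)) -> (m <= k)%N}.
  have ex : exists m, (N' <= m)%N && (a m <= e / 2 / (s + 1)).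
    by exists (maxn N' N2); rewrite leq_maxl N2P// leq_maxr.
  by case: (ex_minnP ex) => m mP mmin; exists m.
exists m; first by apply: leq_trans N'm; exact: leq_maxl.
rewrite (big_cat_nat _ N'm)//= -/s mulrDr [leRHS](splitr e) lerD//.
  apply: le_trans (ler_wpM2r s0 am) _.
  rewrite mulrAC ler_pdivrMr ?ltr_wpDl// ler_wpM2l ?(ltW e2)//.
  by rewrite lerDl.
rewrite mulr_sumr; apply: le_trans (N1P _ _ (leq_maxr _ _) N'm).
rewrite big_nat_cond [leRHS]big_nat_cond.
apply: ler_sum => k /andP[/andP[N'k km] _].
rewrite expr2 ler_wpM2r//; apply: le_trans am _.
rewrite leNgt; apply/negP => /ltW ak.
by have := mmin k; rewrite N'k ak => /(_ isT); rewrite leqNgt km.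
Qed.

End SquareSummable.

(** * Convergence of the residual *)

Section GreedyResidual.
Context {R : realType} {H : hilbertType R}.
(** [A_dual] is the form in which a sum of [M] operators preserving [S], each
    of norm at most [kappa], enters the argument, with [q = M * kappa]: its
    left-hand side is estimated term by term by the dual norm of [x]. *)
Variables (S : set H) (A : H -> H) (c q : R) (u z : nat -> H).
Hypothesis SZ : forall t y, S y -> S (t *: y).
Hypothesis S_total : dense (linspan S).
Hypothesis A_dual : forall x K, 0 <= K ->
  (forall w, S w -> `|'<x, w>| <= K * `|w|) ->
  forall w, S w -> `|'<x, A w>| <= K * (q * `|w|).
Hypothesis A_le : forall x, `|A x| <= q * `|x|.
Hypotheses (c_ge0 : 0 <= c) (q_ge0 : 0 <= q).
Hypothesis cq_lt1 : 2 * c * q + q ^+ 2 < 1.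
Hypothesis uz : forall n, best_approx S (u n) (z n).
Hypothesis uz_dual : forall n w, S w -> `|'<u n - z n, w>| <= c * `|z n| * `|w|.
Hypothesis uS : forall n, u n.+1 = u n - z n - A (z n).

Let Sz n : S (z n) := (uz n).1.

Lemma residual_step n :
  `|u n.+1| ^+ 2 <= `|u n| ^+ 2 - (1 - 2 * c * q - q ^+ 2) * `|z n| ^+ 2.
Proof.
rewrite uS; apply: (best_approx_step SZ (uz n)) => //.
rewrite (_ : c * q * _ = c * `|z n| * (q * `|z n|)); last by ring.
exact: A_dual (mulr_ge0 c_ge0 (normr_ge0 _)) (@uz_dual n) _ (Sz n).
Qed.

Let rho_gt0 : 0 < 1 - 2 * c * q - q ^+ 2.
Proof. by move: cq_lt1; lra. Qed.

Lemma residual_sqr_decreasing m n : (m <= n)%N -> `|u n| ^+ 2 <= `|u m| ^+ 2.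
Proof.
elim: n => [|n IH]; first by rewrite leqn0 => /eqP ->.
rewrite leq_eqVlt => /predU1P[->//|/IH]; apply: le_trans.
apply: le_trans (residual_step n) _.
by rewrite gerBl mulr_ge0// ?sqr_ge0 ?ltW.
Qed.

Lemma best_approx_square_summable n :
  \sum_(0 <= k < n) `|z k| ^+ 2 <= `|u 0%N| ^+ 2 / (1 - 2 * c * q - q ^+ 2).
Proof.
rewrite ler_pdivlMr// mulrC.
suff : `|u n| ^+ 2 + (1 - 2 * c * q - q ^+ 2) * \sum_(0 <= k < n) `|z k| ^+ 2
    <= `|u 0%N| ^+ 2 by have := sqr_ge0 `|u n|; lra.
elim: n => [|n IH]; first by rewrite big_geq// mulr0 addr0.
by rewrite big_nat_recr//= mulrDr; have := residual_step n; lra.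
Qed.

(** Up to a small error, [g] is a finite combination of elements of [S], on
    which ['<u n, _>] is controlled by [`|z n|], hence tends to [0]. *)
Lemma residual_weak_cvg0 g e : 0 < e ->
  exists N, forall n, (N <= n)%N -> `|'<u n, g>| <= e.
Proof.
move=> e0; have u0 : 0 < `|u 0%N| + 1 by rewrite ltr_wpDl.
have d0 : 0 < e / 2 / (`|u 0%N| + 1) by rewrite !divr_gt0.
have [|h0 [/= gh [p [coef [v [Sv h0E]]]]]] :=
    S_total _ (ball_open g (e / 2 / (`|u 0%N| + 1))).
  by exists g; exact: ballxx d0.
set K := \sum_i `|coef i| * `|v i|.
have K0 : 0 <= K by apply: sumr_ge0 => i _; rewrite mulr_ge0.
have K1 : 0 < e / 2 / (K + 1) by rewrite !divr_gt0// ltr_wpDl.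
have [N NP] := square_summable_cvg0 (fun k => normr_ge0 (z k))
  best_approx_square_summable K1.
move: gh; rewrite h0E => gh; exists N => n Nn.
set h := \sum_i _ in gh.
rewrite -[g](subrK h) innerDr [leRHS](splitr e).
apply: le_trans (ler_normD _ _) _; apply: lerD.
  apply: le_trans (cauchy_schwarz _ _) _.
  have un : `|u n| <= `|u 0%N| + 1.
    apply: ler_wpDr => //.
    by rewrite -ler_sqr ?nnegrE// residual_sqr_decreasing.
  move: gh; rewrite -ball_normE/= ltr_pdivlMr// => /ltW; apply: le_trans.
  by rewrite mulrC ler_wpM2l.
rewrite /h inner_sumr; apply: le_trans (ler_norm_sum _ _ _) _.
apply: (@le_trans _ _ (`|z n| * K)).
  rewrite mulr_sumr; apply: ler_sum => i _.
  rewrite innerZr normrM mulrCA ler_wpM2l//.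
  exact: best_approx_dual_norm SZ (uz n) _ (Sv i).
apply: le_trans (ler_wpM2r K0 (NP n Nn)) _.
by rewrite mulrAC ler_pdivrMr ?ltr_wpDl// ler_wpM2l ?lerDl// divr_ge0// ltW.
Qed.

Lemma residual_telescope m : u 0%N - u m = \sum_(0 <= k < m) (z k + A (z k)).
Proof.
elim: m => [|m IH]; first by rewrite big_geq// subrr.
by rewrite big_nat_recr//= -IH uS !opprD !opprK !addrA.
Qed.

(** Expand [u m = u 0 - \sum_(k < m) (z k + A (z k))] in the second argument of
    ['<u m, u m>] and use that [`|z m|] bounds the dual norm of [u m]. *)
Lemma residual_sqr_le m :
  `|u m| ^+ 2 <= `|'<u m, u 0%N>|
     + (1 + q) * (`|z m| * \sum_(0 <= k < m) `|z k|).
Proof.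
rewrite -inner_normE -{2}[u m](subKr (u 0%N)) residual_telescope.
rewrite innerDr innerNr; apply: lerD; first exact: ler_norm.
apply: le_trans (ler_norm _) _; rewrite normrN.
rewrite big_mkord inner_sumr; apply: le_trans (ler_norm_sum _ _ _) _.
rewrite big_mkord mulr_sumr mulr_sumr; apply: ler_sum => k _.
rewrite innerDr; apply: le_trans (ler_normD _ _) _.
have um := best_approx_dual_norm SZ (uz m).
have := um _ (Sz k); have := A_dual (normr_ge0 _) um (Sz k); lra.
Qed.

Lemma residual_cvg0 : u @ \oo --> (0 : H).
Proof.
apply/cvgr0Pnorm_le => e e0.
have e2 : 0 < e ^+ 2 / 2 by rewrite divr_gt0 ?exprn_gt0.
have [N NP] := residual_weak_cvg0 (u 0%N) e2.
have q1 : 0 < 1 + q by rewrite ltr_wpDr.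
have [m Nm mP] := square_summable_sparse (fun k => normr_ge0 (z k))
  best_approx_square_summable N (divr_gt0 e2 q1).
exists m => // n /= mn; rewrite -ler_sqr ?nnegrE ?(ltW e0)//.
apply: le_trans (residual_sqr_decreasing mn) _.
apply: le_trans (residual_sqr_le m) _; rewrite [leRHS]splitr.
by apply: lerD; [exact: NP|rewrite mulrC -ler_pdivlMr].
Qed.

End GreedyResidual.

(** * Small perturbations of the identity *)

Section SmallPerturbation.
Context {R : realType} {H : hilbertType R}.
Variables (A : {linear H -> H}) (q : R).
Hypotheses (q_ge0 : 0 <= q) (q_lt1 : q < 1).
Hypothesis A_le : forall x, `|A x| <= q * `|x|.

Lemma small_perturbation_lower x : (1 - q) * `|x| <= `|x + A x|.
Proof.
have : `|x| <= `|x + A x| + `|A x|.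
  by rewrite -{1}[x](addrK (A x)); exact: ler_normB.
by have := A_le x; lra.
Qed.

(** A solution is a fixed point of the contraction [x |-> u - A x]. *)
Lemma small_perturbation_surjective (u : H) : exists f, f + A f = u.
Proof.
pose F := totalfun (fun x : H => u - A x).
have Fc : @is_contraction R H H setT setT F.
  exists (NngNum q_ge0); split => //= -[x y] _ /=.
  rewrite /F/totalfun_ (_ : u - A x - (u - A y) = A (y - x)).
    by rewrite [`|x - y|]distrC A_le.
  by rewrite [RHS]linearB opprB addrC addrA subrK.
have [f _ ff] := banach_fixed_point Fc closedT (ex_intro _ 0 I).
by exists f; rewrite {1}ff /F /totalfun_ subrK.
Qed.

End SmallPerturbation.

(** * The fixed-point PGD algorithm *)

Section PGD.
Context {R : realType} {Hx Hv H : hilbertType R}.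
Variables (tens : {bilinear Hx -> Hv -> H}).
Variables (a : {biscalar H}) (b : {scalar H}) (A : {linear H -> H}) (beta : H).
Hypothesis bE : forall g, b g = '<beta, g>.
Hypothesis aE : forall g1 g2 : H, a g1 g2 = '<A g1, g2>.

(** Completing the square; the bracket does not depend on [g]. *)
Lemma pgd_energyE f g :
  pgd_energy a b f g = 2^-1 * '<beta - f - A f - g, beta - f - A f - g>
    + (pgd_energy a b f 0 - 2^-1 * '<beta - f - A f, beta - f - A f>).
Proof.
rewrite /pgd_energy addr0 !aE !bE !innerE.
rewrite (innerC f beta) (innerC (A f) beta) (innerC (A f) f).
rewrite (innerC g beta) (innerC g f) (innerC g (A f)); lra.
Qed.

Lemma pgd_argminP f r s : pgd_argmin tens a b f (r, s) <->
  best_approx (pure_tensors tens) (beta - f - A f) (tens r s).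
Proof.
have E_le g h : (pgd_energy a b f g <= pgd_energy a b f h) =
    (`|beta - f - A f - g| <= `|beta - f - A f - h|).
  rewrite (pgd_energyE f g) (pgd_energyE f h) lerD2r ler_pM2l ?invr_gt0//.
  by rewrite !inner_normE ler_sqr ?nnegrE.
split=> [rs|[_ rs] [r' s']]; rewrite /= ?E_le.
  split=> [|_ [r' [s' ->]]]; first by exists r, s.
  by rewrite -E_le; exact: (rs (r', s')).
by apply: rs; exists r', s'.
Qed.

End PGD.

Theorem proposition2 (R : realType) (H Hx Hv : hilbertType R)
  (tens : {bilinear Hx -> Hv -> H})
  (tens_incl : tensor_subspace tens)
  (tens_dense : dense (linspan (pure_tensors tens)))
  (tens_closed : weakly_closed (pure_tensors tens))
  (b : {scalar H}) (b_cont : continuous (b : H -> R))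
  (a : {biscalar H}) (a_cont : continuous (fun g : H * H => a g.1 g.2 : R))
  (A : {linear H -> H}) (A_cont : continuous A)
  (aE : forall g1 g2 : H, a g1 g2 = '<A g1, g2>)
  (g0 : H) :
  (forall n (f : nat -> H) (r : nat -> Hx) (s : nat -> Hv),
     pgd_upto tens a b g0 n f r s ->
     exists (r' : Hx) (s' : Hv), pgd_argmin tens a b (f n) (r', s'))
  /\
  (forall (M : nat) (Ax : 'I_M -> {linear Hx -> Hx})
     (Av : 'I_M -> {linear Hv -> Hv}) (T : 'I_M -> {linear H -> H}),
     (forall mu, continuous (Ax mu)) ->
     (forall mu, continuous (Av mu)) ->
     (forall mu, is_tensor_operator tens (Ax mu) (Av mu) (T mu)) ->
     (forall g : H, A g = \sum_mu T mu g) ->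
     let kappa := \big[Num.max/0]_mu opnorm (T mu) in
     (is_hilbert_tensor tens /\ 3 * M%:R * kappa < 1) \/
     5 * M%:R * kappa < 1 ->
     exists f : H,
       [/\ forall g : H, '<f, g> + a f g = b g,
           forall f' : H, (forall g : H, '<f', g> + a f' g = b g) -> f' = f &
           forall (fn : nat -> H) (r : nat -> Hx) (s : nat -> Hv),
             pgd_run tens a b g0 fn r s -> fn @ \oo --> f]).
Proof.
have [beta bE] : exists beta : H, forall g, b g = '<beta, g>.
  have /linear_boundedP/pinfty_ex_gt0[C _ bC] : bounded_near b (nbhs 0).
    exact/linear_bounded_continuous.
  by apply: (@riesz R H b C) => // [|t x]; [exact: linearD|exact: linearZ].
split=> [n f r s _|M Ax Av T _ _ T_tens AE kappa small].
  have S0 : pure_tensors tens !=set0 by exists (tens 0 0), 0, 0.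
  have [_ [r' [s' ->]] rs_min] :=
    best_approx_exists (beta - f n - A (f n)) S0 tens_closed.
  exists r', s'; apply/(pgd_argminP tens bE aE); split=> //.
  by exists r', s'.
set S := pure_tensors tens; set q := M%:R * kappa.
have SZ t y : S y -> S (t *: y).
  by move=> [r1 [s1 ->]]; exists (t *: r1), s1; rewrite linearZl_LR.
have kappa_ge0 : 0 <= kappa by exact: bigmax_ge_id.
have q_ge0 : 0 <= q by rewrite mulr_ge0.
have T_le mu x : `|T mu x| <= kappa * `|x|.
  apply: le_trans (opnormP (T_tens mu).1 x) _.
  by rewrite ler_wpM2r// /kappa; exact: le_bigmax.
have A_le x : `|A x| <= q * `|x|.
  rewrite AE; apply: le_trans (ler_norm_sum _ _ _) _.
  have -> : q * `|x| = \sum_(mu < M) kappa * `|x|.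
    by rewrite sumr_const card_ord -mulrA mulr_natl.
  by apply: ler_sum => mu _; exact: T_le.
have A_dual x K : 0 <= K -> (forall w, S w -> `|'<x, w>| <= K * `|w|) ->
    forall w, S w -> `|'<x, A w>| <= K * (q * `|w|).
  move=> K0 xK w Sw; rewrite AE inner_sumr.
  apply: le_trans (ler_norm_sum _ _ _) _.
  have -> : K * (q * `|w|) = \sum_(mu < M) K * (kappa * `|w|).
    by rewrite sumr_const card_ord -mulrA mulr_natl mulrnAr.
  apply: ler_sum => mu _; apply: le_trans (xK _ _) _.
    have [r1 [s1 ->]] := Sw; rewrite (T_tens mu).2.
    by exists (Ax mu r1), (Av mu s1).
  by rewrite ler_wpM2l.
(* With [c = 1], [3 * q < 1] gives [2 * q + q ^+ 2 < 1]; with [c = 2],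
   [5 * q < 1] gives [4 * q + q ^+ 2 < 1]. *)
have [c [c_ge0 cq c_dual]] : exists c, [/\ 0 <= c, 2 * c * q + q ^+ 2 < 1 &
    forall u z, best_approx S u z ->
      forall w, S w -> `|'<u - z, w>| <= c * `|z| * `|w|].
  case: small; rewrite -mulrA -/q.
    move=> [[_ tensE] q3]; exists 1; split=> //; first by nra.
    move=> u z uz w Sw; rewrite mul1r.
    exact: hilbert_tensor_residual_dual_norm tensE uz _ Sw.
  move=> q5; exists 2; split=> //; first by nra.
  by move=> u z uz w Sw; exact: (best_approx_residual_dual_norm SZ uz).
have q_lt1 : q < 1 by case: small => [[_]|]; rewrite -mulrA -/q; lra.
have [f fE] := small_perturbation_surjective q_ge0 q_lt1 A_le beta.
exists f; split=> [g|f' f'E|fn r s run].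
- by rewrite aE bE -fE innerDl.
- have f'A : f' + A f' = beta.
    apply/subr0_eq/eqP; rewrite -normr_eq0 -sqrf_eq0 -inner_normE.
    by rewrite [X in X == _]innerDl innerNl -bE -f'E aE innerDl subrr.
  have : (1 - q) * `|f' - f| <= 0.
    apply: le_trans (small_perturbation_lower A_le _) _.
    by rewrite linearB addrACA -opprD f'A fE subrr normr0.
  by rewrite pmulr_rle0 ?subr_gt0// normr_le0 subr_eq0 => /eqP.
(* The pair produced at step [n] is numbered [n.+1]. *)
pose u n := beta - fn n - A (fn n).
have step n : pgd_argmin tens a b (fn n) (r n.+1, s n.+1) /\
    fn n.+1 = fn n + tens (r n.+1) (s n.+1) by exact: (run n.+1).2.
have u0 : u @ \oo --> (0 : H).
  apply: (@residual_cvg0 _ _ S A c q u (fun n => tens (r n.+1) (s n.+1))) => //.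
  + by move=> n; apply/(pgd_argminP tens bE aE); exact: (step n).1.
  + move=> n w; apply: c_dual.
    by apply/(pgd_argminP tens bE aE); exact: (step n).1.
  + move=> n; rewrite /u (step n).2 [A (_ + _)]linearD !opprD !addrA.
    by congr (_ - _); exact: addrAC.
apply/cvgrPdist_le => e e0.
have q1 : 0 < 1 - q by rewrite subr_gt0.
move/cvgr0_norm_le: u0 => /(_ _ (mulr_gt0 q1 e0)); apply: filterS => n un.
rewrite -(ler_pM2l q1); apply: le_trans un.
apply: le_trans (small_perturbation_lower A_le _) _.
by rewrite linearB addrACA -opprD fE /u opprD addrA.
Qed.
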